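(* Let $(X,\mathcal{A},\mu,\tau,C_\tau)$ be a composition dynamical system on $\mathbb{L}^{\varphi,h}(\mu)$. Then $C_\tau$ is positively expansive if and only if for every $A\in\mathcal{A}$ with $0<\mu(A)<\infty$, $$\inf_{n\in\mathbb{N}}\ \varphi^{-1}\!\left(\frac{1}{\int_0^{\mu(\tau^{-n}(A))}h(t)\,dt}\right)=0 .$$
   Context: Let $(X,\mathcal{A},\mu)$ be a measure space. For a measurable $g$, its distribution function is $\mu_g(\lambda)=\mu\{x:|g(x)|>\lambda\}$ and its non-increasing rearrangement is $g^*(t)=\inf\{\lambda>0:\mu_g(\lambda)\le t\}$. An Orlicz function is a convex $\varphi:[0,\infty)\to[0,\infty)$ with $\varphi(0)=0$ and $\varphi(s)\to\infty$ as $s\to\infty$; here $\varphi$ is assumed continuous and strictly increasing, and $\varphi^{-1}$ denotes its inverse. A weight is a locally integrable, non-increasing function $h:[0,\mu(X))\to(0,\infty)$. The Orlicz–Lorentz space is $\mathbb{L}^{\varphi,h}(\mu)=\{g \text{ measurable}: I_{\varphi,h}(\lambda g)<\infty \text{ for some }\lambda>0\}$ with $I_{\varphi,h}(g)=\int_0^{\mu(X)}\varphi(g^*(t))h(t)\,dt$, normed by $\|g\|_{\varphi,h}=\inf\{\lambda>0: I_{\varphi,h}(g/\lambda)\le 1\}$ (functions equal a.e. identified). For $A\in\mathcal{A}$ with $0<\mu(A)<\infty$ one has $\|\chi_A\|_{\varphi,h}=1/\varphi^{-1}\big(1/\int_0^{\mu(A)}h(t)\,dt\big)$. A composition dynamical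 system $(X,\mathcal{A},\mu,\tau,C_\tau)$ means: $(X,\mathcal{A},\mu)$ is $\sigma$-finite; $\tau:X\to X$ is injective and bi-measurable; there is $M>0$ with $\mu(\tau^{-1}(A))\le M\mu(A)$ for all $A\in\mathcal{A}$; and $C_\tau g=g\circ\tau$ is the (bounded) composition operator on $\mathbb{L}^{\varphi,h}(\mu)$. A bounded operator $T$ on a Banach space $Y$ with unit sphere $S_Y$ is positively expansive if for every $y\in S_Y$ there is $n\in\mathbb{N}$ with $\|T^n y\|\ge 2$ (equivalently, $\sup_{n\in\mathbb{N}}\|T^n y\|=\infty$ for every $y\ne0$). *)

(* Defs.v *)
From HB Require Import structures.
From mathcomp Require Import all_boot all_order all_algebra.
From mathcomp Require Import all_classical all_reals all_analysis.
Set Implicit Arguments. Unset Strict Implicit. Unset Printing Implicit Defensive.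
Import Order.TTheory GRing.Theory Num.Theory.
Import numFieldNormedType.Exports.
Local Open Scope classical_set_scope.
Local Open Scope ring_scope.

Section OrliczLorentz.
Context {R : realType} {d : measure_display} {T : measurableType d}.
Variable mu : {measure set T -> \bar R}.

Definition distrib (g : T -> R) (l : R) : \bar R :=
  mu [set x | l < `|g x|].

(* non-increasing rearrangement g^*(t) = inf {lambda > 0 : mu_g(lambda) <= t}
   (value +oo when the set is empty) *)
Definition rearr (g : T -> R) (t : R) : \bar R :=
  ereal_inf [set (l%:E) | l in [set l : R | 0 < l /\ (distrib g l <= t%:E)%E]].

Definition phiE (phi : R -> R) (x : \bar R) : \bar R :=
  match x with
  | r%:E => (phi r)%:E
  | +oo%E => +oo%E
  | -oo%E => 0%E
  end.

Definition modular (phi h : R -> R) (g : T -> R) : \bar R :=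
  (\int[lebesgue_measure]_(t in [set t : R | (0 <= t)%R /\ (t%:E < mu setT)%E])
      (phiE phi (rearr g t) * (h t)%:E))%E.

Definition inOL (phi h : R -> R) (g : T -> R) : Prop :=
  measurable_fun setT g /\
  exists l : R, 0 < l /\ (modular phi h (fun x => (l * g x)%R) < +oo)%E.

Definition OLnorm (phi h : R -> R) (g : T -> R) : R :=
  inf [set l : R | 0 < l /\ (modular phi h (fun x => (g x / l)%R) <= 1)%E].

Definition Hint (h : R -> R) (s : R) : \bar R :=
  (\int[lebesgue_measure]_(t in `[0%R, s]) (h t)%:E)%E.

End OrliczLorentz.

Definition orlicz_function {R : realType} (phi : R -> R) : Prop :=
  [/\ (forall x y t : R, 0 <= x -> 0 <= y -> 0 <= t <= 1 ->
         phi (t * x + (1 - t) * y) <= t * phi x + (1 - t) * phi y),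
      phi 0 = 0,
      {within `[0, +oo[, continuous phi},
      (forall x y : R, 0 <= x -> x < y -> phi x < phi y) &
      phi x @[x --> +oo] --> +oo].

Definition is_inverse_on_nonneg {R : realType} (phi phiinv : R -> R) : Prop :=
  (forall s : R, 0 <= s -> phiinv (phi s) = s) /\
  (forall u : R, 0 <= u -> 0 <= phiinv u /\ phi (phiinv u) = u).

Definition weight {R : realType} (muX : \bar R) (h : R -> R) : Prop :=
  [/\ (forall t : R, 0 <= t -> (t%:E < muX)%E -> 0 < h t),
      (forall s t : R, 0 <= s -> s <= t -> (t%:E < muX)%E -> h t <= h s) &
      (forall s : R, 0 <= s -> (s%:E < muX)%E ->
         lebesgue_measure.-integrable `[0%R, s] (fun t => (h t)%:E))].

(* term phi^{-1}(1 / int_0^{m} h), with the convention 1/0 = +oo, phi^{-1}(+oo) = +oo *)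
Definition expterm {R : realType} (phiinv h : R -> R) (m : \bar R) : \bar R :=
  if Hint h (fine m) == 0%E then +oo%E
  else (phiinv (1 / fine (Hint h (fine m))))%:E.

Definition pos_expansive {R : realType} {d : measure_display} {T : measurableType d}
  (mu : {measure set T -> \bar R}) (phi h : R -> R) (tau : T -> T) : Prop :=
  forall y : T -> R, inOL mu phi h y -> OLnorm mu phi h y = 1 ->
    exists n : nat, (0 < n)%N /\ 2 <= OLnorm mu phi h (y \o iter n tau).

(* Main.v *)
Require Import Defs.
From HB Require Import structures.
From mathcomp Require Import all_boot all_order all_algebra.
From mathcomp Require Import all_classical all_reals all_analysis.
From mathcomp Require Import measurable_realfun lra.
Import Order.TTheory GRing.Theory Num.Theory.
Import numFieldNormedType.Exports.
Local Open Scope classical_set_scope.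
Local Open Scope ring_scope.

(** Write [e A] for [phiinv (1 / int_0^(mu A) h)], so that the norm of [c 1_A] is [c / e A].
    If [C_tau] is positively expansive, applying the definition to [e A * 1_A] yields
    [n > 0] with [e (tau^-n A) <= e A / 2]; iterating from [tau^-n A] drives the infimum
    to 0.  Conversely, a function [y] of norm 1 satisfies [|y| >= l 1_A] for some [l > 0]
    and some [A] of finite positive measure, so the norm of [y \o tau^n] is at least
    [l / e (tau^-n A)], which exceeds 2 as soon as [e (tau^-n A) < l / 2]. *)

(** Each superlevel set in [D] is again an interval. This gives measurability of the weight and of
    the modular integrand. *)
Lemma nonincreasing_emeasurable (R : realType) (D : set R)
    (f : R -> \bar R) :
  is_interval D ->
  (forall s t, D s -> D t -> s <= t -> (f t <= f s)%E) ->
  measurable_fun D f.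
Proof.
move=> iD f_ni mD; apply: (measurability _ (ErealGenOInfty.measurableE R) _ mD).
move=> _ [_ [r ->] <-]; apply: is_interval_measurable => s t/=.
rewrite !in_itv/= !andbT => -[Ds fs] [Dt ft] u /andP[su ut].
have Du : D u by apply: (iD s t) => //; rewrite su.
by split=> //; rewrite in_itv/= andbT (lt_le_trans ft)// f_ni.
Qed.

(** * Orlicz functions and their inverses *)

Section orlicz_function_lemmas.
Context {R : realType} {phi phiinv : R -> R}.
Hypothesis phiO : orlicz_function phi.

Lemma orlicz_le (x y : R) : 0 <= x -> x <= y -> phi x <= phi y.
Proof.
case: phiO => _ _ _ inc _ x0; rewrite le_eqVlt => /predU1P[->//|xy].
exact/ltW/inc.
Qed.

Lemma orlicz_ge0 (x : R) : 0 <= x -> 0 <= phi x.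
Proof. by move=> x0; case: (phiO) => _ <- _ _ _; exact: orlicz_le. Qed.

(** Convexity between [x] and [0], together with [phi 0 = 0]. *)
Lemma orlicz_scale (a x : R) : 0 <= a <= 1 -> 0 <= x -> phi (a * x) <= a * phi x.
Proof.
move=> a01 x0; case: (phiO) => cvx phi0 _ _ _.
by have := cvx x 0 a x0 (lexx 0) a01; rewrite phi0 !mulr0 !addr0.
Qed.

Lemma phiE_le (x y : \bar R) :
  (0 <= x)%E -> (x <= y)%E -> (phiE phi x <= phiE phi y)%E.
Proof.
move: x y => [x| |] [y| |] //=; rewrite ?lee_fin ?leey//.
exact: orlicz_le.
Qed.

Lemma phiE_ge0 (x : \bar R) : (0 <= x)%E -> (0 <= phiE phi x)%E.
Proof. by move: x => [x| |]//=; rewrite !lee_fin; exact: orlicz_ge0. Qed.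

Lemma phiE_scale (a : R) (x : \bar R) : 0 < a <= 1 -> (0 <= x)%E ->
  (phiE phi (a%:E * x) <= a%:E * phiE phi x)%E.
Proof.
move=> /andP[a0 a1]; case: x => [x||] /=; rewrite ?lee_fin => x0//.
  by apply: orlicz_scale => //; rewrite (ltW a0).
by rewrite gt0_muley ?lte_fin.
Qed.

Hypothesis phiI : is_inverse_on_nonneg phi phiinv.

Lemma phiinv_gt0 {u : R} : 0 < u -> 0 < phiinv u.
Proof.
move=> u0; case: phiI => _ /(_ u (ltW u0))[pu0 pu].
rewrite lt_neqAle pu0 andbT eq_sym; apply/eqP => pu_eq0.
by case: phiO => _ phi0 _ _ _; move: u0; rewrite -pu pu_eq0 phi0 ltxx.
Qed.

(** Strict monotonicity makes [phi] and [phiinv] adjoint; this turns a modular bound on an indicator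
    into a bound on its scalar factor. *)
Lemma orlicz_le_phiinv {x u : R} : 0 <= x -> 0 <= u ->
  (phi x <= u) = (x <= phiinv u).
Proof.
move=> x0 u0; case: phiI => _ /(_ u u0)[pu0 pu]; apply/idP/idP => xu.
  rewrite leNgt; apply/negP => ux; case: phiO => _ _ _ inc _.
  by have := inc _ _ pu0 ux; rewrite pu ltNge xu.
by rewrite -pu; exact: orlicz_le.
Qed.

End orlicz_function_lemmas.

(** * Distribution functions and non-increasing rearrangements *)

Section rearrangement.
Context {R : realType} {d : measure_display} {T : measurableType d}.
Variable mu : {measure set T -> \bar R}.
Implicit Types f g : T -> R.

Lemma measurable_gt_norm g (l : R) : measurable_fun setT g ->
  measurable [set x | l < `|g x|].
Proof.
move=> mg; rewrite (_ : [set _ | _] = setT `&` (Num.norm \o g) @^-1` `]l, +oo[).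
  by apply: (measurableT_comp (@normr_measurable R setT) mg).
by rewrite setTI; apply/seteqP; split=> x; rewrite /= in_itv/= andbT.
Qed.

Lemma le_distrib f g (l : R) : measurable_fun setT f -> measurable_fun setT g ->
  (forall x, `|f x| <= `|g x|) -> (distrib mu f l <= distrib mu g l)%E.
Proof.
move=> mf mg fg; apply: le_measure; rewrite ?inE; [exact: measurable_gt_norm..|].
by move=> x /= lf; exact: lt_le_trans (fg x).
Qed.

Lemma distrib_scale g (a l : R) : 0 < a ->
  distrib mu (fun x => a * g x) (a * l) = distrib mu g l.
Proof.
move=> a0; congr (mu _); apply/seteqP.
by split=> x /=; rewrite normrM (gtr0_norm a0) ltr_pM2l.
Qed.

Lemma rearr_ge0 g (t : R) : (0 <= rearr mu g t)%E.
Proof. by apply: le_ereal_inf_tmp => _ [l [l0 _] <-]; rewrite lee_fin ltW. Qed.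

Lemma rearr_nonincreasing g (s t : R) : s <= t ->
  (rearr mu g t <= rearr mu g s)%E.
Proof.
move=> st; apply: ereal_inf_le_tmp => _ [l [l0 gl] <-]; exists l => //.
by split=> //; rewrite (le_trans gl)// lee_fin.
Qed.

Lemma le_rearr f g (t : R) : measurable_fun setT f -> measurable_fun setT g ->
  (forall x, `|f x| <= `|g x|) -> (rearr mu f t <= rearr mu g t)%E.
Proof.
move=> mf mg fg; apply: ereal_inf_le_tmp => _ [l [l0 gl] <-]; exists l => //.
by split=> //; apply: le_trans gl; exact: le_distrib.
Qed.

Lemma rearr_scale g (a t : R) : 0 < a ->
  (rearr mu (fun x => (a * g x)%R) t <= a%:E * rearr mu g t)%E.
Proof.
move=> a0; rewrite -lee_pdivrMl//; apply: le_ereal_inf_tmp => _ [l [l0 gl] <-].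
rewrite lee_pdivrMl//; apply: ereal_inf_lbound; exists (a * l)%R => //=.
by rewrite mulr_gt0// distrib_scale.
Qed.

(** The hypothesis on [distrib] expresses [g = 0] almost everywhere; every positive level is then
    admissible. *)
Lemma rearr_eq0 g (t : R) : 0 <= t ->
  (forall l, 0 < l -> distrib mu g l = 0%E) -> rearr mu g t = 0%E.
Proof.
move=> t0 g0; apply/eqP; rewrite eq_le rearr_ge0 andbT.
apply/lee_addgt0Pr => e e0; rewrite add0e; apply: ereal_inf_lbound.
by exists e => //; split=> //; rewrite g0// lee_fin.
Qed.

Lemma distrib_indic (A : set T) (c l : R) : 0 < c -> 0 < l ->
  distrib mu (fun x => c * \1_A x) l = if l < c then mu A else 0%E.
Proof.
move=> c0 l0; have nE x : `|c * \1_A x| = c * \1_A x :> R.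
  by rewrite ger0_norm// mulr_ge0// ltW.
case: ifPn => lc.
  congr (mu _); apply/seteqP; split=> x; rewrite /= nE indicE.
    by case: (boolP (x \in A)); rewrite ?inE// mulr0 ltNge (ltW l0).
  by move=> Ax; rewrite mem_set// mulr1.
rewrite /distrib (_ : [set _ | _] = set0) ?measure0//.
apply/seteqP; split=> x //=; rewrite nE indicE; case: (x \in A).
  by rewrite mulr1 (negbTE lc).
by rewrite mulr0 ltNge (ltW l0).
Qed.

Lemma rearr_indic (A : set T) (c t : R) : 0 < c -> 0 <= t ->
  rearr mu (fun x => c * \1_A x) t = if (t%:E < mu A)%E then c%:E else 0%E.
Proof.
(* If [t < mu A], the level [c] is admissible and no level below [c] is; otherwise all positive
   levels are admissible and the infimum is 0. *)
move=> c0 t0; case: ifPn => tA.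
  apply/eqP; rewrite eq_le; apply/andP; split.
    by apply: ereal_inf_lbound; exists c => //; rewrite /= distrib_indic// ltxx.
  apply: le_ereal_inf_tmp => _ [l [l0 +] <-]; rewrite distrib_indic//.
  case: ifPn; first by rewrite leNgt tA.
  by rewrite -leNgt lee_fin.
apply/eqP; rewrite eq_le rearr_ge0 andbT.
apply/lee_addgt0Pr => e e0; rewrite add0e; apply: ereal_inf_lbound.
exists e => //; split=> //; rewrite distrib_indic//.
by case: ifP => _; rewrite ?lee_fin// leNgt.
Qed.

End rearrangement.

(** * Integrals of the weight *)

Section weights.
Context {R : realType} {h : R -> R} {b : \bar R}.
Hypothesis hw : weight b h.

Let dom : set R := [set t | 0 <= t /\ (t%:E < b)%E].

Lemma is_interval_weight_dom : is_interval dom.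
Proof.
move=> s t [s0 sb] [t0 tb] u /andP[su ut]; split; first exact: le_trans su.
by apply: le_lt_trans tb; rewrite lee_fin.
Qed.

Lemma weight_gt0 {t : R} : dom t -> 0 < h t.
Proof. by move=> [t0 tb]; case: hw => + _ _; exact. Qed.

Lemma weight_le {s t : R} : dom s -> dom t -> s <= t -> h t <= h s.
Proof. by move=> [s0 _] [_ tb] st; case: hw => _ + _; exact. Qed.

Lemma weight_dom_itv {m : R} : (m%:E <= b)%E -> `[0, m[ `<=` dom.
Proof.
move=> mb t; rewrite /= in_itv/= => /andP[t0 tm]; split=> //.
by apply: lt_le_trans mb; rewrite lte_fin.
Qed.

Lemma measurable_weight {m : R} : (m%:E <= b)%E ->
  measurable_fun `[0, m[ (fun t => (h t)%:E).
Proof.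
move=> mb; apply: nonincreasing_emeasurable; first exact: interval_is_interval.
move=> s t /(weight_dom_itv mb) ? /(weight_dom_itv mb) ?.
rewrite lee_fin; exact: weight_le.
Qed.

(** For [m = b] the weight is controlled only on the half-open interval; the endpoint is a null
    set. *)
Lemma HintE {m : R} : (m%:E <= b)%E ->
  Hint h m = (\int[lebesgue_measure]_(t in `[0%R, m[) (h t)%:E)%E.
Proof. by move=> mb; rewrite /Hint integral_itv_bndo_bndc//; exact: measurable_weight. Qed.

(** By monotonicity the integral lies between [h (m / 2) * (m / 2)] and [h 0 * m]. The midpoint is
    used because [m] itself may fall outside the domain of the weight. *)
Lemma Hint_fin_gt0 {m : R} : 0 < m -> (m%:E <= b)%E ->
  Hint h m \is a fin_num /\ (0 < Hint h m)%E.
Proof.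
move=> m0 mb; have mh := measurable_weight mb.
have d0 : dom 0 by apply: (weight_dom_itv mb); rewrite /= in_itv/= lexx.
have h0 t : t \in `[0, m[ -> (0 <= (h t)%:E)%E.
  by move=> /(weight_dom_itv mb) /weight_gt0 /ltW; rewrite lee_fin.
have gt0 : (0 < Hint h m)%E.
  have dm2 : m / 2 \in `[0, m[ by rewrite in_itv/=; apply/andP; split; lra.
  rewrite HintE//; apply: (@lt_le_trans _ _ ((h (m / 2))%:E * (m / 2)%:E)%E).
    rewrite -EFinM lte_fin mulr_gt0//; last by lra.
    exact/weight_gt0/weight_dom_itv/dm2.
  have sub : `[0, m / 2[ `<=` `[0, m[.
    by move=> t; rewrite /= !in_itv/= => /andP[-> /lt_le_trans->//]; lra.
  have -> : (m / 2)%:E = lebesgue_measure (`[0, m / 2[ : set R).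
    by rewrite lebesgue_measure_itv/= lte_fin ifT ?sube0//; lra.
  rewrite -integral_cst//.
  apply: (@le_trans _ _ (\int[lebesgue_measure]_(t in `[0%R, (m / 2)%R[) (h t)%:E)%E).
    apply: ge0_le_integral => //.
    - by move=> t _; rewrite lee_fin ltW// weight_gt0//; apply: weight_dom_itv dm2.
    - by apply: measurable_funS mh.
    - move=> t tm; rewrite lee_fin; apply: weight_le.
      + exact/weight_dom_itv/sub.
      + exact: weight_dom_itv dm2.
      + by move: tm; rewrite /= in_itv/= => /andP[_ /ltW].
  by apply: ge0_subset_integral.
split=> //; rewrite ge0_fin_numE; last exact: ltW.
rewrite HintE//.
apply: (@le_lt_trans _ _ (\int[lebesgue_measure]_(t in `[0%R, m[) (h 0)%:E)%E).
  apply: ge0_le_integral => //.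
  move=> t tm; rewrite lee_fin; apply: weight_le => //.
    exact: weight_dom_itv tm.
  by move: tm; rewrite /= in_itv/= => /andP[].
rewrite integral_cst//= lebesgue_measure_itv/= lte_fin m0 sube0 -EFinM.
by rewrite ltry.
Qed.

End weights.

(** By the convention for [1 / 0], a null preimage never brings the infimum closer to 0. *)
Lemma expterm0 (R : realType) (phiinv h : R -> R) : expterm phiinv h 0 = +oo%E.
Proof. by rewrite /expterm /Hint set_itv1 integral_set1 eqxx. Qed.

(** * The modular and the Luxemburg norm *)

Section orlicz_lorentz.
Context {R : realType} {d : measure_display} {T : measurableType d}.
Variables (mu : {measure set T -> \bar R}) (phi phiinv h : R -> R).
Hypothesis phiO : orlicz_function phi.
Hypothesis hw : weight (mu setT) h.
Implicit Types (f g : T -> R) (A : set T).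

Let dom : set R := [set t | 0 <= t /\ (t%:E < mu setT)%E].

Let integrand g (t : R) : \bar R := (phiE phi (rearr mu g t) * (h t)%:E)%E.

Let integrand_ge0 g t : dom t -> (0 <= integrand g t)%E.
Proof.
move=> Dt; apply: mule_ge0; first exact/phiE_ge0/rearr_ge0.
by rewrite lee_fin ltW// (weight_gt0 hw).
Qed.

Let measurable_dom : measurable dom.
Proof. apply: is_interval_measurable; exact: is_interval_weight_dom. Qed.

(* Both factors are nonnegative and nonincreasing, so no measurability of [phiE] is needed. *)
Let measurable_integrand g : measurable_fun dom (integrand g).
Proof.
apply: nonincreasing_emeasurable; first exact: is_interval_weight_dom.
move=> s t Ds Dt st; apply: lee_pmul.
- exact/phiE_ge0/rearr_ge0.
- by rewrite lee_fin ltW// (weight_gt0 hw).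
- by apply: phiE_le => //; [exact: rearr_ge0|exact: rearr_nonincreasing].
- by rewrite lee_fin (weight_le hw).
Qed.

Lemma modular_ge0 g : (0 <= modular mu phi h g)%E.
Proof. by apply: integral_ge0 => t; exact: integrand_ge0. Qed.

Lemma le_modular f g : measurable_fun setT f -> measurable_fun setT g ->
  (forall x, `|f x| <= `|g x|) ->
  (modular mu phi h f <= modular mu phi h g)%E.
Proof.
move=> mf mg fg; apply: ge0_le_integral => //.
- exact: integrand_ge0.
- exact: measurable_integrand.
- exact: measurable_integrand.
move=> t Dt; apply: lee_pmul.
- exact/phiE_ge0/rearr_ge0.
- by rewrite lee_fin ltW// (weight_gt0 hw).
- by apply: phiE_le => //; [exact: rearr_ge0|exact: le_rearr].
- by [].
Qed.

(** Convexity of [phi], passed through the rearrangement; it serves to shrink a finite modular below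
    1. *)
Lemma modular_scale g (a : R) : 0 < a <= 1 ->
  (modular mu phi h (fun x => (a * g x)%R) <= a%:E * modular mu phi h g)%E.
Proof.
move=> /andP[a0 a1]; rewrite /modular -ge0_integralZl//; first last.
- by rewrite lee_fin ltW.
- exact: integrand_ge0.
- exact: measurable_integrand.
apply: ge0_le_integral => //.
- exact: integrand_ge0.
- exact: measurable_integrand.
- by apply: measurable_funeM; exact: measurable_integrand.
move=> t Dt; rewrite muleA; apply: lee_pmul => //.
- exact/phiE_ge0/rearr_ge0.
- by rewrite lee_fin ltW// (weight_gt0 hw).
apply: (@le_trans _ _ (phiE phi (a%:E * rearr mu g t)%E)).
  by apply: phiE_le => //; [exact: rearr_ge0|exact: rearr_scale].
by apply: phiE_scale; rewrite ?a0// rearr_ge0.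
Qed.

Lemma modular_eq0 g : (forall l, 0 < l -> distrib mu g l = 0%E) ->
  modular mu phi h g = 0%E.
Proof.
move=> g0; apply: integral0_eq => t [t0 _]; rewrite rearr_eq0//=.
by case: phiO => _ -> _ _ _; rewrite mul0e.
Qed.

Lemma modular_indic A (c : R) : measurable A -> (mu A < +oo)%E -> 0 < c ->
  modular mu phi h (fun x => c * \1_A x) = ((phi c)%:E * Hint h (fine (mu A)))%E.
Proof.
move=> mA Aoo c0; set m := fine (mu A).
have mE : mu A = m%:E by rewrite fineK// ge0_fin_numE.
have mb : (m%:E <= mu setT)%E by rewrite -mE le_measure// inE.
have sub := weight_dom_itv mb.
rewrite (HintE hw mb) -ge0_integralZl//; first last.
- by rewrite lee_fin orlicz_ge0// ltW.
- by move=> t /sub Dt; rewrite lee_fin ltW// (weight_gt0 hw).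
- exact: (measurable_weight hw mb).
(* Extension by zero turns the integral over [[0, m[] into one over the whole domain; beyond [m] the
   rearrangement is 0 and [phi 0 = 0]. *)
rewrite -(setIidr sub) integral_mkcondr; apply: eq_integral => t.
rewrite inE => -[t0 tb]; rewrite rearr_indic// mE lte_fin patchE.
rewrite mem_setE in_itv/= t0/=; case: ifP => _ //=.
by case: phiO => _ -> _ _ _; rewrite mul0e.
Qed.

(** Makes the set defining [OLnorm] nonempty, so that [inf] is a true infimum and not a default
    value. *)
Lemma inOL_modular_le1 g : inOL mu phi h g ->
  exists2 l, 0 < l & (modular mu phi h (fun x => (g x / l)%R) <= 1)%E.
Proof.
move=> [mg [l [l0 lgoo]]]; set I := modular mu phi h _ in lgoo.
have I0 : (0 <= I)%E by exact: modular_ge0.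
have Ifin : I \is a fin_num by rewrite ge0_fin_numE.
have i0 : 0 <= fine I by rewrite fine_ge0.
(* Chosen so that [a <= 1] and [a * I <= 1]. *)
set a := (1 + fine I)^-1.
have a0 : 0 < a by rewrite invr_gt0; lra.
have a1 : a <= 1 by rewrite invf_le1; lra.
exists (a * l)^-1; first by rewrite invr_gt0 mulr_gt0.
rewrite (_ : (fun x => _) = (fun x => a * (l * g x))); last first.
  by apply/funext => x; rewrite invrK mulrC mulrA.
apply: (le_trans (modular_scale _ _ _)); first by rewrite a0.
rewrite -/I -(fineK Ifin) -EFinM lee_fin /a mulrC ler_pdivrMr; lra.
Qed.

Let norm_set g : set R :=
  [set l : R | 0 < l /\ (modular mu phi h (fun x => (g x / l)%R) <= 1)%E].

Let norm_set_lbound g : lbound (norm_set g) 0.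
Proof. by move=> l [/ltW]. Qed.

(** Every scalar admissible for [g] is admissible for [f], and membership of [g] in the space
    provides one. *)
Lemma le_OLnorm f g : measurable_fun setT f -> inOL mu phi h g ->
  (forall x, `|f x| <= `|g x|) -> OLnorm mu phi h f <= OLnorm mu phi h g.
Proof.
move=> mf gOL fg; have [l l0 gl] := inOL_modular_le1 _ gOL.
apply: lb_le_inf; first by exists l.
move=> k [k0 gk]; apply: ge_inf; first by exists 0; exact: norm_set_lbound.
split; first exact: k0.
apply: (le_trans _ gk); apply: le_modular.
- exact: measurable_funM.
- by apply: measurable_funM => //; case: gOL.
- by move=> x; rewrite !normrM ler_wpM2r.
Qed.

Lemma OLnorm_eq0 g : (forall l, 0 < l -> distrib mu g l = 0%E) ->
  OLnorm mu phi h g = 0.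
Proof.
move=> g0; have E l : 0 < l -> norm_set g l.
  move=> l0; split=> //; rewrite modular_eq0// => k k0.
  rewrite (_ : (fun x => _) = (fun x => l^-1 * g x)); last first.
    by apply/funext => x; rewrite mulrC.
  (* The distribution of [g / l] at [k] is that of [g] at [k * l], hence 0. *)
  have := distrib_scale mu g l^-1 (k * l); rewrite invr_gt0 => /(_ l0).
  by rewrite mulrCA mulVf ?gt_eqF// mulr1 => ->; rewrite g0// mulr_gt0.
apply/eqP; rewrite eq_le; apply/andP; split; last first.
  by apply: lb_le_inf; [exists 1; exact: E|exact: norm_set_lbound].
apply/ler_addgt0Pr => e e0; rewrite add0r; apply: ge_inf; last exact: E.
by exists 0; exact: norm_set_lbound.
Qed.

Hypothesis phiI : is_inverse_on_nonneg phi phiinv.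

(** With [H] the integral of [h] up to [mu A], the modular of [(c / l) 1_A] is [phi (c / l) * H]. It
    is at most 1 exactly when [c / phiinv (1 / H) <= l], so the admissible scalars form a closed
    half-line. *)
Lemma OLnorm_indic A : measurable A -> (0 < mu A)%E -> (mu A < +oo)%E ->
  exists2 e, 0 < e & expterm phiinv h (mu A) = e%:E /\
    forall c, 0 < c -> inOL mu phi h (fun x => c * \1_A x) /\
      OLnorm mu phi h (fun x => c * \1_A x) = c / e.
Proof.
move=> mA A0 Aoo; set m := fine (mu A).
have mE : mu A = m%:E by rewrite fineK// ge0_fin_numE.
have mb : (m%:E <= mu setT)%E by rewrite -mE le_measure// inE.
have m0 : 0 < m by rewrite -lte_fin -mE.
have [Hfin H0] := Hint_fin_gt0 hw m0 mb.
set H := fine (Hint h m).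
have HE : Hint h m = H%:E by rewrite fineK.
have {}H0 : 0 < H by rewrite -lte_fin -HE.
have u0 : 0 < 1 / H by rewrite divr_gt0.
have e0 := phiinv_gt0 phiO phiI u0.
exists (phiinv (1 / H)) => //; split.
  by rewrite /expterm -/m HE/= eqe gt_eqF.
move=> c c0.
have mc : measurable_fun setT (fun x => c * \1_A x : R).
  by apply: measurable_funM => //; exact: measurable_indic.
split.
  split=> //; exists 1; split=> //.
  rewrite (_ : (fun x => _) = (fun x => c * \1_A x)); last first.
    by apply/funext => x; rewrite mul1r.
  by rewrite modular_indic// -/m HE -EFinM ltry.
have E l : 0 < l -> norm_set (fun x => c * \1_A x) l <-> c / phiinv (1 / H) <= l.
  move=> l0; rewrite /norm_set /=.
  rewrite (_ : (fun x => _) = (fun x => c / l * \1_A x)); last first.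
    by apply/funext => x; rewrite mulrAC.
  rewrite modular_indic ?divr_gt0// -/m HE -EFinM lee_fin -ler_pdivlMr//.
  rewrite (orlicz_le_phiinv phiO phiI)// ?divr_ge0 ?(ltW c0, ltW l0, ltW H0)//.
  by rewrite !ler_pdivrMr// mulrC; split=> [[]|].
have ce0 : 0 < c / phiinv (1 / H) by rewrite divr_gt0.
apply/eqP; rewrite eq_le; apply/andP; split.
  apply: ge_inf; first by exists 0; exact: norm_set_lbound.
  by apply/E.
apply: lb_le_inf; first by exists (c / phiinv (1 / H)); apply/E.
by move=> l ln; have [l0 _] := ln; apply/E.
Qed.

End orlicz_lorentz.

(** * Iterated preimages and compositions *)

Section composition_iterates.
Context {R : realType} {d : measure_display} {T : measurableType d}.
Variables (mu : {measure set T -> \bar R}) (tau : T -> T).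
Hypothesis mtau : measurable_fun setT tau.

Lemma measurable_fun_iter n : measurable_fun setT (iter n tau).
Proof.
elim: n => [|n IH]; first exact: measurable_id.
exact: (measurableT_comp mtau IH).
Qed.

Lemma measurable_preimage_iter n (A : set T) : measurable A ->
  measurable (iter n tau @^-1` A).
Proof. by move=> mA; rewrite -[X in measurable X]setTI; exact: measurable_fun_iter. Qed.

Lemma measure_preimage_iter_lty (M : R) :
  (forall A : set T, measurable A -> (mu (tau @^-1` A) <= M%:E * mu A)%E) ->
  forall n (A : set T), measurable A -> (mu A < +oo)%E ->
    (mu (iter n tau @^-1` A) < +oo)%E.
Proof.
move=> tauM; elim=> [//|n IH] A mA Aoo.
have mtA : measurable (tau @^-1` A) by exact: (measurable_preimage_iter 1).
rewrite (_ : iter n.+1 tau @^-1` A = iter n tau @^-1` (tau @^-1` A)) //.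
apply: IH => //; apply: (le_lt_trans (tauM A mA)).
have Afin : mu A \is a fin_num by rewrite ge0_fin_numE.
by rewrite -(fineK Afin) -EFinM ltry.
Qed.

Lemma inOL_iter (phi h : R -> R) :
  (forall g : T -> R, inOL mu phi h g -> inOL mu phi h (g \o tau)) ->
  forall n (g : T -> R), inOL mu phi h g -> inOL mu phi h (g \o iter n tau).
Proof.
move=> tauOL; elim=> [|n IH] g gOL; first exact: gOL.
exact: (IH (g \o tau) (tauOL g gOL)).
Qed.

End composition_iterates.

(** If no piece of [B] cut out by the finite-measure cover had positive measure, countable
    subadditivity would make [B] null. *)
Lemma sigma_finite_subset {R : realType} {d : measure_display}
    {T : measurableType d} (mu : {measure set T -> \bar R}) (B : set T) :
  sigma_finite setT mu -> measurable B -> mu B != 0%E ->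
  exists A, [/\ measurable A, A `<=` B, (0 < mu A)%E & (mu A < +oo)%E].
Proof.
move=> [F FT mF] mB B0; apply: contrapT => noA; move/eqP: B0; apply.
rewrite -[B]setIT FT setI_bigcupr; apply/eqP; rewrite -measure_le0.
have mBF n : measurable (B `&` F n) by apply: measurableI => //; case: (mF n).
apply: (le_trans (measure_sigma_subadditive _ mBF _ (@subset_refl _ _))).
  exact: bigcupT_measurable.
rewrite eseries0// => n _ _; apply/eqP; apply: contrapT => /negP n0; apply: noA.
exists (B `&` F n); split=> //; first by rewrite lt0e n0 measure_ge0.
by case: (mF n) => mFn; apply: le_lt_trans; rewrite le_measure// inE.
Qed.

Theorem mainTheorem2 (R : realType) (d : measure_display) (T : measurableType d)
  (mu : {measure set T -> \bar R}) (tau : T -> T) (M : R)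
  (phi phiinv h : R -> R) :
  sigma_finite setT mu ->
  injective tau ->
  measurable_fun setT tau ->
  (forall A : set T, measurable A -> measurable (tau @` A)) ->
  0 < M ->
  (forall A : set T, measurable A -> (mu (tau @^-1` A) <= M%:E * mu A)%E) ->
  orlicz_function phi ->
  is_inverse_on_nonneg phi phiinv ->
  weight (mu setT) h ->
  (forall g : T -> R, inOL mu phi h g -> inOL mu phi h (g \o tau)) ->
  (exists K : R, forall g : T -> R, inOL mu phi h g ->
      OLnorm mu phi h (g \o tau) <= K * OLnorm mu phi h g) ->
  pos_expansive mu phi h tau <->
  (forall A : set T, measurable A -> (0 < mu A)%E -> (mu A < +oo)%E ->
     ereal_inf [set expterm phiinv h (mu (iter n tau @^-1` A)) | n in [set n : nat | (0 < n)%N]]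
       = 0%E).

Proof.
move=> sf _ mtau _ _ tauM phiO phiI hw tauOL _.
have mpre := measurable_preimage_iter tau mtau.
have fpre := measure_preimage_iter_lty mu tau mtau M tauM.
have norm_indic := OLnorm_indic mu phi phiinv h phiO hw phiI.
split=> [pe A mA A0 Aoo|inf0 y yOL y1]; last first.
  have my : measurable_fun setT y by case: yOL.
  (* If all positive levels had null superlevel sets, the norm of [y] would be 0 instead of 1. *)
  have [l l0 yl] : exists2 l, 0 < l & distrib mu y l != 0%E.
    apply: contrapT => ny; move/eqP: y1; apply/negP.
    rewrite (OLnorm_eq0 mu phi h phiO) 1?eq_sym ?oner_eq0// => l l0.
    by apply/eqP; apply: contrapT => /negP yl; apply: ny; exists l.
  have [A [mA Ay A0 Aoo]] :=
    sigma_finite_subset mu _ sf (measurable_gt_norm y l my) yl.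
  have : (ereal_inf [set expterm phiinv h (mu (iter n tau @^-1` A))
                    | n in [set n : nat | (0 < n)%N]] < (l / 2)%:E)%E.
    by rewrite inf0// lte_fin; lra.
  move=> /ereal_inf_lt[_ [n n0 <-]] small; exists n; split=> //.
  (* A null preimage would have [expterm] equal to [+oo], which is not below [l / 2]. *)
  have B0 : (0 < mu (iter n tau @^-1` A))%E.
    rewrite lt0e measure_ge0 andbT; apply/negP => /eqP B0.
    by move: small; rewrite B0 expterm0.
  have [e e0 [eE /(_ _ l0)[_ norm_le]]] := norm_indic _ (mpre n A mA) B0 (fpre n A mA Aoo).
  move: small; rewrite eE lte_fin => el.
  have le2 : 2 <= l / e by rewrite ler_pdivlMr//; clear -el; lra.
  (* The norm of [l] times the indicator of the preimage is [l / e]; this function is dominated by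
     [y \o iter n tau], since [|y| > l] on [A]. *)
  apply: (le_trans le2); rewrite -norm_le; apply: (le_OLnorm mu phi h phiO hw).
  - by apply: measurable_funM => //; apply: measurable_indic; exact: mpre.
  - exact: inOL_iter.
  - move=> x; rewrite indicE.
    case: (boolP (x \in _)) => [|_]; rewrite ?mulr0 ?normr0// inE => Ax.
    by rewrite mulr1 gtr0_norm//; apply/ltW/Ay.
(* Expansivity applied to [e 1_B], of norm 1, gives [e / e' >= 2]. Positivity of the measure of the
   new preimage is recorded so that the step can be repeated. *)
have halve B e : measurable B -> (0 < mu B)%E -> (mu B < +oo)%E ->
    expterm phiinv h (mu B) = e%:E ->
    exists n e', [/\ (0 < n)%N, (0 < mu (iter n tau @^-1` B))%E,
      expterm phiinv h (mu (iter n tau @^-1` B)) = e'%:E & e' <= e / 2].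
  move=> mB B0 Boo; have [e1 e0 [-> norm1]] := norm_indic B mB B0 Boo => -[<-].
  have [yOL y1] := norm1 _ e0; rewrite divff ?gt_eqF// in y1.
  have [n [n0 n2]] := pe _ yOL y1.
  (* Otherwise the composed indicator would vanish almost everywhere and have norm 0, not at least
     2. *)
  have C0 : (0 < mu (iter n tau @^-1` B))%E.
    rewrite lt0e measure_ge0 andbT; apply/negP => /eqP C0.
    move: n2; rewrite (OLnorm_eq0 mu phi h phiO); first by rewrite lern0.
    by move=> l l0; rewrite (distrib_indic mu (iter n tau @^-1` B))// C0 if_same.
  have [e' e'0 [e'E /(_ _ e0)[_ norm2]]] := norm_indic _ (mpre n B mB) C0 (fpre n B mB Boo).
  exists n, e'; split=> //.
  have {}n2 : 2 <= e1 / e' by rewrite -norm2.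
  by move: n2; rewrite ler_pdivlMr//; clear; lra.
have [e e0 [eE _]] := norm_indic A mA A0 Aoo.
(* The exponent is [k.+1] because [k = 0] already uses one halving, which keeps [n] positive; the
   iteration counts add up. *)
have iter_halve k : exists n e', [/\ (0 < n)%N, (0 < mu (iter n tau @^-1` A))%E,
    expterm phiinv h (mu (iter n tau @^-1` A)) = e'%:E & e' <= e / 2 ^+ k.+1].
  elim: k => [|k [n [e1 [n0 B0 e1E e1k]]]]; first exact: halve.
  have [m [e2 [m0 C0 e2E e21]]] := halve _ _ (mpre n A mA) B0 (fpre n A mA Aoo) e1E.
  have preE : iter m tau @^-1` (iter n tau @^-1` A) = iter (n + m) tau @^-1` A.
    by apply/seteqP; split=> x; rewrite /= iterD.
  exists (n + m)%N, e2; rewrite -preE; split=> //; first by rewrite addn_gt0 n0.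
  apply: (le_trans e21); rewrite exprSr invfM mulrA; lra.
apply/eqP; rewrite eq_le; apply/andP; split.
  apply/lee_addgt0Pr => r r0; rewrite add0e.
  (* By the Archimedean property [e / r < k], and [k < 2 ^ k.+1], so [e / 2 ^ k.+1 <= r]. *)
  pose k := Num.bound (e / r).
  have [n [e' [n0 _ e'E e'k]]] := iter_halve k.
  apply: ge_ereal_inf; exists e'%:E; first by exists n.
  rewrite lee_fin (le_trans e'k)// ler_pdivrMr ?exprn_gt0//.
  rewrite -ler_pdivrMl// mulrC (le_trans (ltW (archi_boundP _)))//.
    by rewrite divr_ge0// ltW.
  by rewrite -/k -natrX ler_nat ltnW// (ltn_trans (ltnSn k))// ltn_expl.
(* Each term is [+oo] for a null preimage and a positive real otherwise. *)
apply: le_ereal_inf_tmp => _ [n n0 <-].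
have [B0|B0] := eqVneq (mu (iter n tau @^-1` A)) 0%E; first by rewrite B0 expterm0.
have {}B0 : (0 < mu (iter n tau @^-1` A))%E by rewrite lt0e B0 measure_ge0.
have [e' e'0 [-> _]] := norm_indic _ (mpre n A mA) B0 (fpre n A mA Aoo).
by rewrite lee_fin ltW.
Qed.
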